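(* Let $r\in\mathbb{Z}$, $\ell\in\mathbb{N}$, and let $(d_1,\ldots,d_\ell)$ be a Ferrers sequence. If $1\le r\le\partial(d_1,\ldots,d_\ell)$, then $$R_r(d_1,\ldots,d_\ell;q)=R_r(d_1,\ldots,d_{\ell-1};q)\,q^{d_\ell}+\sum_{j=1}^{d_\ell}R_{r-1}(d_2-1,\ldots,d_{\ell-1}-1,j-1;q)\,q^{d_\ell-j}.$$ Moreover, $R_0(d_1,\ldots,d_\ell;q)=q^{d_1+\cdots+d_\ell}$, and $R_r(d_1,\ldots,d_\ell;q)=0$ if $r>\partial(d_1,\ldots,d_\ell)$ or $r<0$.
   Context: $\mathbb{N}$ denotes the positive integers. A Ferrers diagram is a finite set $\mathcal{F}\subseteq\mathbb{N}\times\mathbb{N}$ such that $(i,j)\in\mathcal{F}$ implies $(s,t)\in\mathcal{F}$ for all $1\le s\le i$, $1\le t\le j$. The $i$-th diagonal is $\Delta_i=\{(s,i-s+1):s\in\{1,\ldots,i\}\}$. A placement of non-attacking rooks is a set of cells no two sharing a row or column index; $\mathrm{NAR}(\mathcal{F},r)$ is the set of such placements $P\subseteq\mathcal{F}$ with $|P|=r$. For $P$, $\mathrm{ATK}(P)=\bigcup_{(a,b)\in P}\big(\{(s,b):1\le s\le a\}\cup\{(a,t):1\le t\le b\}\big)$ and $\mathrm{inv}(\mathcal{F},P)=|\mathcal{F}\setminus\mathrm{ATK}(P)|$. The $r$-th $q$-rook polynomial is $R_r(\mathcal{F};q)=\sum_{P\in\mathrm{NAR}(\mathcal{F},r)}q^{\mathrm{inv}(\mathcal{F},P)}$,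 with $R_r=0$ if $r<0$ or $\mathrm{NAR}(\mathcal{F},r)=\emptyset$, and $R_0(\mathcal{F};q)=q^{|\mathcal{F}|}$. A sequence $(d_1,\ldots,d_\ell)$ of non-negative integers is a Ferrers sequence if it is $(0,\ldots,0)$ or there is $r\in\{1,\ldots,\ell\}$ with $d_i=i$ for $1\le i\le r$ and $d_r\ge d_{r+1}\ge\cdots\ge d_\ell$; these are exactly the sequences $(|\Delta_i\cap\mathcal{F}|)_{i\le\ell}$ of Ferrers diagrams $\mathcal{F}$ with $\Delta_i\cap\mathcal{F}=\emptyset$ for $i>\ell$. For a Ferrers sequence, $R_r(d_1,\ldots,d_\ell;q)$ denotes $R_r(\mathcal{F};q)$ for any Ferrers diagram $\mathcal{F}$ with $|\Delta_i\cap\mathcal{F}|=d_i$ for $i\le\ell$ and $|\Delta_i\cap\mathcal{F}|=0$ for $i>\ell$ (this does not depend on the choice of $\mathcal{F}$), and $\partial(d_1,\ldots,d_\ell)=\max\{r:\mathrm{NAR}(\mathcal{F},r)\neq\emptyset\}=\max_i d_i$. The empty sequence corresponds to the empty diagram. *)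

(* Defs.v *)
From HB Require Import structures.
From mathcomp Require Import all_boot all_order all_algebra finmap.
From mathcomp Require Import boolp classical_sets.

Set Implicit Arguments.
Unset Strict Implicit.
Unset Printing Implicit Defensive.

Local Open Scope fset_scope.
Local Open Scope nat_scope.

(* Cells are pairs of positive integers, encoded as pairs of [nat]: rows,
   columns, diagonals and sequence entries are all numbered from 1. *)
Notation cell := (nat * nat)%type.

Definition ferrers_diagram (F : {fset cell}) : Prop :=
  forall i j, (i, j) \in F ->
    [/\ 1 <= i, 1 <= j &
        forall s t, 1 <= s <= i -> 1 <= t <= j -> (s, t) \in F].

Definition diagonal (i : nat) : {fset cell} :=
  [fset (s, i - s + 1) | s in iota 1 i].

Definition nonattacking (P : {fset cell}) : bool :=
  all2rel (fun c c' : cell =>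
             (c != c') ==> (c.1 != c'.1) && (c.2 != c'.2)) P.

(* For negative [r] no placement qualifies, so [NAR F r] is empty. *)
Definition NAR (F : {fset cell}) (r : int) : {fset {fset cell}} :=
  [fset P in fpowerset F | nonattacking P && (Posz #|` P| == r)].

Definition ATK (P : {fset cell}) : {fset cell} :=
  \big[fsetU/fset0]_(c <- P)
    ([fset (s, c.2) | s in iota 1 c.1] `|` [fset (c.1, t) | t in iota 1 c.2]).

Definition inv (F P : {fset cell}) : nat := #|` F `\` ATK P|.

Definition rook_poly (r : int) (F : {fset cell}) : {poly int} :=
  (\sum_(P <- NAR F r) 'X^(inv F P))%R.

(* max {k : NAR F k is nonempty}; placements inside F have at most |F| cells,
   which bounds the range of k. *)
Definition max_rooks (F : {fset cell}) : nat :=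
  \max_(k < #|` F|.+1 | NAR F (Posz k) != fset0) k.

(* [entry d i] is d_i. *)
Definition entry (d : seq nat) (i : nat) : nat := nth 0 d i.-1.

Definition ferrers_seq (d : seq nat) : Prop :=
  (forall i, 1 <= i <= size d -> entry d i = 0) \/
  (exists2 r, 1 <= r <= size d &
     (forall i, 1 <= i <= r -> entry d i = i) /\
     (forall i, r <= i < size d -> entry d i.+1 <= entry d i)).

Definition has_diagonals (F : {fset cell}) (d : seq nat) : Prop :=
  [/\ ferrers_diagram F,
      forall i, 1 <= i <= size d -> #|` diagonal i `&` F| = entry d i
    & forall i, size d < i -> #|` diagonal i `&` F| = 0].

(* The common value of [f F] over all Ferrers diagrams F with diagonal sequence
   d, as a definite description: the value is meaningful only if such an F
   exists and [f F] does not depend on it.  Otherwise it is unspecified. *)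
Definition on_diagrams (T : choiceType) (x0 : T) (f : {fset cell} -> T)
    (d : seq nat) : T :=
  xget x0 (fun x => forall F, has_diagonals F d -> f F = x).

Definition rook_poly_seq (r : int) (d : seq nat) : {poly int} :=
  on_diagrams 0%R (rook_poly r) d.

Definition max_rooks_seq (d : seq nat) : nat := on_diagrams 0 max_rooks d.

(* (d_1, ..., d_(l-1)) *)
Definition drop_last (d : seq nat) : seq nat := take (size d).-1 d.

(* (d_2 - 1, ..., d_(l-1) - 1, j - 1).  For l = 1 this is (0) rather than the
   empty sequence; both belong to the empty diagram. *)
Definition reduced_seq (d : seq nat) (j : nat) : seq nat :=
  rcons [seq x.-1 | x <- behead (drop_last d)] j.-1.

(* Main.v *)
(* Every cell c of the last diagonal of a Ferrers diagram F is a corner.  If no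
   rook stands on c then c is not attacked; if a rook does, it attacks exactly
   the row and the column of c.  Hence
     R_r(F) = q R_r(F minus c) + R_(r-1)(F / c),
   where F / c is F with the row and column of c deleted.  The diagonals of
   F minus c are (d_1, ..., d_l - 1) and those of F / c are
   (d_2 - 1, ..., d_l - 1): a rectangle loses one cell on each diagonal when its
   last row and column are removed.  So both terms are determined by the
   diagonals, which by induction shows that R_r(F) is, and emptying the last
   diagonal one corner at a time gives the recursion. *)

Require Import Defs.
From HB Require Import structures.
From mathcomp Require Import all_boot all_order all_algebra finmap zify.
From mathcomp Require Import boolp classical_sets.

Import Order.TTheory GRing.Theory Num.Theory.
Local Open Scope ring_scope.

Section RookPolynomials.
Local Open Scope fset_scope.
Local Open Scope nat_scope.
Set Implicit Arguments.
Unset Strict Implicit.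
Unset Printing Implicit Defensive.
Implicit Types (F G P Q : {fset cell}) (d : seq nat) (c x y p : cell) (r : int).

(** * Diagonals *)

(* Diagonals are numbered from 0 here: diag_size F k counts Delta_(k+1). *)
Definition diag_size F k := \sum_(i < k.+1) ((i.+1, k.+1 - i) \in F).

Lemma in_diagonal k c :
  (c \in Defs.diagonal k) = [&& 0 < c.1, 0 < c.2 & c.1 + c.2 == k.+1].
Proof.
case: c => s t /=; apply/imfsetP/idP => [[i /=]|st].
  by rewrite mem_iota => ki [-> ->]; lia.
by exists s => /=; [rewrite mem_iota | congr (_, _)]; lia.
Qed.

Lemma card_diagonal F k : #|` Defs.diagonal k.+1 `&` F| = diag_size F k.
Proof.
(* I is kept opaque so that simplification does not unfold iota. *)
have [I EI] : exists I, I = iota 0 k.+1 by exists (iota 0 k.+1).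
have memI i : (i \in I) = (i < k.+1) by rewrite EI mem_iota.
have -> : Defs.diagonal k.+1 `&` F =
  [fset x in [seq (i.+1, k.+1 - i) | i <- I & (i.+1, k.+1 - i) \in F]].
  apply/fsetP => -[s t]; rewrite !inE in_diagonal /=.
  apply/andP/mapP => [[st stF]|[i]].
    have E : (s, t) = (s.-1.+1, k.+1 - s.-1) by congr (_, _); lia.
    by exists s.-1; [rewrite mem_filter -E stF memI; lia | exact: E].
  by rewrite mem_filter memI => /andP[iF ki] [-> ->]; split=> //; lia.
rewrite card_fseq undup_id; last first.
  rewrite map_inj_uniq ?filter_uniq ?EI ?iota_uniq //.
  by move=> i j [].
rewrite size_map size_filter -sum1_count big_mkcond /=.
rewrite /diag_size -(big_mkord xpredT (fun i => ((i.+1, k.+1 - i) \in F) : nat)).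
by rewrite EI /index_iota subn0; apply: eq_bigr => i _; case: ifP.
Qed.

Lemma has_diagonalsE F d :
  has_diagonals F d <-> ferrers_diagram F /\ diag_size F =1 nth 0 d.
Proof.
split=> [[fF H1 H2]|[fF H]].
  split=> // k; rewrite -card_diagonal.
  have [kd|dk] := ltnP k (size d); first by rewrite H1.
  by rewrite H2 // nth_default.
split=> // -[|k] //; rewrite ?card_diagonal ?H //.
by move=> dk; rewrite nth_default.
Qed.

Lemma ferrers_gt0 {F c} : ferrers_diagram F -> c \in F -> 0 < c.1 /\ 0 < c.2.
Proof. by case: c => i j fF /fF[]. Qed.

Lemma diag_size_gt0 F k :
  reflect (exists2 c, c \in F & [/\ 0 < c.1, 0 < c.2 & c.1 + c.2 = k.+2])
    (0 < diag_size F k).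
Proof.
rewrite lt0n sum_nat_eq0 negb_forall; apply: (iffP existsP).
  move=> [i /=]; rewrite eqb0 negbK => iF; exists (i.+1, k.+1 - i) => //=.
  by have := ltn_ord i; split; lia.
move=> [[s t] /= cF [s0 t0 st]].
have sk : s.-1 < k.+1 by lia.
exists (Ordinal sk) => /=; rewrite eqb0 negbK.
by have -> : (s.-1.+1, k.+1 - s.-1) = (s, t) by congr (_, _); lia.
Qed.

Lemma add_gt0_ex (s t : nat) : 0 < s -> 0 < t -> exists k, s + t = k.+2.
Proof. by move=> s0 t0; exists (s + t - 2); lia. Qed.

(** Double counting: each cell of [F] lies on exactly one diagonal, and its index is below [size d]
    because later diagonals are empty. *)
Lemma card_ferrers F d : has_diagonals F d -> #|` F| = sumn d.
Proof.
move=> /has_diagonalsE[fF H].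
rewrite card_fset_sum1 sumnE (big_nth 0) big_mkord.
transitivity (\sum_(c <- F) \sum_(k < size d) (c.1 + c.2 == k.+2)).
  rewrite big_seq [RHS]big_seq; apply: eq_bigr => c cF.
  have [c1 c2] := ferrers_gt0 fF cF.
  have [k Ek] := add_gt0_ex c1 c2.
  have Hk : k < size d.
    rewrite ltnNge; apply/negP => dk.
    have : 0 < diag_size F k by apply/diag_size_gt0; exists c.
    by rewrite H nth_default.
  rewrite (bigD1 (Ordinal Hk)) //= Ek eqxx big1 ?addn0 // => j.
  by rewrite -val_eqE /= eq_sym !eqSS => /negPf ->.
rewrite exchange_big; apply: eq_bigr => k _ /=.
rewrite -H -card_diagonal.
have -> : Defs.diagonal k.+1 `&` F = [fset c in F | c.1 + c.2 == k.+2].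
  apply/fsetP => c; rewrite in_fsetI in_diagonal !inE /=.
  have [cF|] := boolP (c \in F); last by rewrite andbF.
  by have [-> ->] := ferrers_gt0 fF cF; rewrite andbT.
rewrite card_fset_sum1 -big_fset_condE [RHS]big_mkcond.
by apply: eq_bigr => c _; case: eqP.
Qed.

(* The cell c lies on Delta_(l+1), the last diagonal meeting F. *)
Definition last_diagonal_cell F l c :=
  [/\ c \in F, c.1 + c.2 = l.+2 & forall k, l < k -> diag_size F k = 0].

(** A cell weakly beyond [c] and different from it has a larger coordinate sum, hence lies on a
    later diagonal, and those are empty. *)
Lemma last_diagonal_corner F l c x : ferrers_diagram F ->
  last_diagonal_cell F l c -> x \in F -> c.1 <= x.1 -> c.2 <= x.2 -> x = c.
Proof.
case: c x => [a b] [s t] fF [cF /= cl lF] xF /= sa tb.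
have [/= s0 t0] := ferrers_gt0 fF xF.
have [k Ek] := add_gt0_ex s0 t0.
have [lk|kl] := ltnP l k; last by congr (_, _); lia.
suff : 0 < diag_size F k by rewrite lF.
by apply/diag_size_gt0; exists (s, t).
Qed.

Lemma ferrers_del_corner F l c : ferrers_diagram F ->
  last_diagonal_cell F l c -> ferrers_diagram (F `\ c).
Proof.
move=> fF cl i j; rewrite in_fsetD1 => /andP[ijc ijF].
have [i0 j0 H] := fF _ _ ijF; split=> // s t si tj.
rewrite in_fsetD1 H // andbT; apply: contra ijc => /eqP sc.
by apply/eqP/(last_diagonal_corner fF cl ijF); rewrite -sc /=; lia.
Qed.

Lemma diag_size_del F l c : ferrers_diagram F -> last_diagonal_cell F l c ->
  forall k, diag_size F k = (k == l) + diag_size (F `\ c) k.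
Proof.
move=> fF [cF cl _] k; have [c1 c2] := ferrers_gt0 fF cF.
rewrite -!card_diagonal fsetIDA (cardfsD1 c) in_fsetI in_diagonal c1 c2 cF cl.
by rewrite andbT /= !eqSS eq_sym.
Qed.

(** [bump h] enumerates the naturals other than [h], so this map undoes the renumbering that follows
    the deletion of row [c.1] and column [c.2]. *)
Definition bump2 c x : cell := (bump c.1 x.1, bump c.2 x.2).

Lemma bump2_inj c : injective (bump2 c).
Proof.
move=> [s t] [s' t'] [] /(can_inj (bumpK _)) -> /(can_inj (bumpK _)) -> //.
Qed.

Lemma bump2_neq c x : (bump2 c x).1 != c.1 /\ (bump2 c x).2 != c.2.
Proof. by rewrite ![_ == c.1]eq_sym ![_ == c.2]eq_sym !neq_bump. Qed.

(* Row c.1 and column c.2 are removed and the remaining rows and columns are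
   renumbered consecutively. *)
Definition delete_cross F c : {fset cell} :=
  [fset (unbump c.1 x.1, unbump c.2 x.2) | x in F & (x.1 != c.1) && (x.2 != c.2)].

Lemma in_delete_cross F c x : (x \in delete_cross F c) = (bump2 c x \in F).
Proof.
have [n1 n2] := bump2_neq c x.
apply/imfsetP/idP => /= [[y]|xF].
  rewrite inE => /andP[yF /andP[y1 y2]] ->.
  by rewrite /bump2 /= !unbumpK // -surjective_pairing.
exists (bump2 c x); first by rewrite !inE xF n1 n2.
by rewrite /= !bumpK -surjective_pairing.
Qed.

Lemma ferrers_delete_cross F l c : ferrers_diagram F ->
  last_diagonal_cell F l c -> ferrers_diagram (delete_cross F c).
Proof.
case: c => a b fF [cF /= cl lF] i j; rewrite in_delete_cross /bump2 /= => ijF.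
have [/= a0 b0] := ferrers_gt0 fF cF.
have [i0 j0 H] := fF _ _ ijF.
split; [move: i0|move: j0|]; rewrite /bump; try lia.
move=> s t si tj; rewrite in_delete_cross /bump2 /=.
by apply: H; move: i0 j0; rewrite /bump; lia.
Qed.

Lemma diag_size_delete_cross F l c : ferrers_diagram F ->
  last_diagonal_cell F l c ->
  forall k, diag_size (delete_cross F c) k = (diag_size F k.+1).-1.
Proof.
case: c => a b fF cl k; have [cF /= lab lF] := cl.
have [/= a0 b0] := ferrers_gt0 fF cF.
have [_ _ rect] := fF _ _ cF.
have [kl|lk] := ltnP k l; last first.
  rewrite lF //; apply/eqP; rewrite -leqn0 leqNgt; apply/diag_size_gt0.
  move=> [[s t]]; rewrite in_delete_cross /= => stF [s0 t0 st].
  (* Since s + t >= a + b, [bump] shifts at least one coordinate, so the image in [F] lies strictly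
     beyond the last diagonal. *)
  have : 0 < diag_size F (bump a s + bump b t - 2).
    apply/diag_size_gt0; exists (bump2 (a, b) (s, t)) => //=.
    by split; rewrite /bump; lia.
  rewrite lF // /bump; lia.
(* The rectangle with corner (a, b) lies in F, so the cell of Delta_(k+2) in row
   min a (k + 2) is in F; the other rows of Delta_(k+2) correspond to those of
   Delta_(k+1) in delete_cross F c through bump a. *)
have Hm : minn a.-1 k.+1 < k.+2 by lia.
rewrite /diag_size [in RHS](bigD1_ord (Ordinal Hm)) //=.
rewrite rect; [|lia|lia].
rewrite add1n /=; apply: eq_bigr => i _.
rewrite in_delete_cross /bump2 /=; congr (nat_of_bool _).
have ik := ltn_ord i.
have [ai|ia] := leqP a i.+1.
  congr (_ \in F); congr (_, _); rewrite /bump; lia.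
have [bi|ib] := leqP b (k.+1 - i).
  congr (_ \in F); congr (_, _); rewrite /bump; lia.
(* The two cells differ here by one column, but both lie in the rectangle. *)
by rewrite !rect //; rewrite /bump; lia.
Qed.

(** * Deletion of a corner *)

Definition attacks p x :=
  (x.2 == p.2) && (0 < x.1 <= p.1) || (x.1 == p.1) && (0 < x.2 <= p.2).

Lemma in_ATK P x : reflect (exists2 p, p \in P & attacks p x) (x \in ATK P).
Proof.
suff E p : (x \in [fset (s, p.2) | s in iota 1 p.1] `|`
             [fset (p.1, t) | t in iota 1 p.2]) = attacks p x.
  apply: (iffP (bigfcupP _ _ _ _)) => [[p /andP[pP _]]|[p pP px]].
    by rewrite E; exists p.
  by exists p; rewrite ?E ?pP.
case: x p => [s t] [a b]; rewrite inE /attacks /=; congr (_ || _).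
  apply/imfsetP/andP => [[i /=]|[/eqP -> sa]].
    by rewrite mem_iota => ia [-> ->]; split=> //; lia.
  by exists s => //=; rewrite mem_iota; lia.
apply/imfsetP/andP => [[i /=]|[/eqP -> sa]].
  by rewrite mem_iota => ia [-> ->]; split=> //; lia.
by exists t => //=; rewrite mem_iota; lia.
Qed.

Lemma nonattackingP P :
  reflect {in P &, forall x y, x.1 = y.1 \/ x.2 = y.2 -> x = y} (nonattacking P).
Proof.
apply: (iffP allrelP) => H x y xP yP.
  have /= := H _ _ xP yP; have [//|_ /andP[/eqP n1 /eqP n2]] := eqVneq x y.
  by case.
apply/implyP => /eqP n; apply/andP; split; apply/eqP => E; apply: n;
  by apply: H => //; tauto.
Qed.

Lemma in_NAR F r P :
  (P \in NAR F r) = [&& P `<=` F, nonattacking P & Posz #|` P| == r].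
Proof. by rewrite !inE /= fpowersetE. Qed.

Definition corner F c :=
  c \in F /\ {in F, forall x, c.1 <= x.1 -> c.2 <= x.2 -> x = c}.

Lemma bump2_surj c y :
  y.1 != c.1 -> y.2 != c.2 -> exists x, y = bump2 c x.
Proof.
move=> n1 n2; exists (unbump c.1 y.1, unbump c.2 y.2).
by rewrite /bump2 /= !unbumpK // -surjective_pairing.
Qed.

(** Inverse of [delete_cross] on nonattacking placements that contain [c]. *)
Definition insert_corner c Q := c |` [fset bump2 c x | x in Q].

Lemma insert_cornerP c Q y :
  reflect (y = c \/ exists2 x, x \in Q & y = bump2 c x) (y \in insert_corner c Q).
Proof.
apply: (iffP (fset1UP _ _ _)) => -[->|]; try by left.
  by case/imfsetP=> x xQ ->; right; exists x.
by case=> x xQ ->; right; apply/imfsetP; exists x.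
Qed.

Lemma corner_in_insert c Q : c \in insert_corner c Q.
Proof. exact: fset1U1. Qed.

Lemma bump2_in_insert c Q x : (bump2 c x \in insert_corner c Q) = (x \in Q).
Proof.
apply/insert_cornerP/idP => [[E|[y yQ /bump2_inj ->//]]|xQ].
  by have := (bump2_neq c x).1; rewrite E eqxx.
by right; exists x.
Qed.

Lemma insert_corner_inj c : injective (insert_corner c).
Proof. by move=> P Q E; apply/fsetP => x; rewrite -(bump2_in_insert c P) E bump2_in_insert. Qed.

Lemma card_insert_corner c Q : #|` insert_corner c Q| = #|` Q|.+1.
Proof.
rewrite cardfsU1 card_imfset /=; last exact: bump2_inj.
case: imfsetP => //= -[x _ E].
by have := (bump2_neq c x).1; rewrite -E eqxx.
Qed.

Lemma nonattacking_insert c Q :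
  nonattacking (insert_corner c Q) = nonattacking Q.
Proof.
apply/nonattackingP/nonattackingP => H.
  move=> x y xQ yQ xy; apply: (@bump2_inj c).
  apply: H; rewrite ?bump2_in_insert //=.
  by case: xy => ->; [left|right].
move=> x y /insert_cornerP[->|[x' x'Q ->]] /insert_cornerP[->|[y' y'Q ->]] //.
- by have [/eqP n1 /eqP n2] := bump2_neq c y'; case=> /esym E.
- by have [/eqP n1 /eqP n2] := bump2_neq c x'; case=> E.
by move=> xy; congr bump2; apply: H => //; case: xy => /(can_inj (bumpK _));
  [left|right].
Qed.

(** A nonattacking placement has no rook but [c] in the row or column of [c], so every other rook is
    in the image of [bump2 c]. *)
Lemma insert_delete_cross c P : nonattacking P -> c \in P ->
  insert_corner c (delete_cross P c) = P.
Proof.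
move=> /nonattackingP nP cP; apply/fsetP => y.
apply/insert_cornerP/idP => [[->//|[x]]|yP].
  by rewrite in_delete_cross => xP ->.
have [->|/eqP yc] := eqVneq y c; [by left|right].
have [||x yx] := @bump2_surj c y.
- by apply/eqP => E; apply: yc; apply: nP => //; left.
- by apply/eqP => E; apply: yc; apply: nP => //; right.
by exists x; rewrite ?in_delete_cross -?yx.
Qed.

Lemma Posz_eq_subr1 (n : nat) r : (Posz n == (r - 1)%R) = (Posz n.+1 == r).
Proof. by rewrite eq_sym subr_eq eq_sym intS addrC. Qed.

Lemma NAR_corner F c r : c \in F ->
  [fset P in NAR F r | c \in P] =
  [fset insert_corner c Q | Q in NAR (delete_cross F c) (r - 1)].
Proof.
move=> cF; apply/fsetP => P; rewrite !inE /= fpowersetE.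
apply/idP/imfsetP => /= [/andP[/and3P[PF nP /eqP PE] cP]|[Q]].
  have E := insert_delete_cross nP cP.
  exists (delete_cross P c) => //; rewrite in_NAR -(nonattacking_insert c) E nP.
  have := card_insert_corner c (delete_cross P c); rewrite E => cardP.
  rewrite andTb Posz_eq_subr1 -cardP PE eqxx andbT.
  apply/fsubsetP => x; rewrite !in_delete_cross; exact: (fsubsetP PF).
rewrite in_NAR Posz_eq_subr1 => /and3P[QF nQ QE] ->.
rewrite corner_in_insert nonattacking_insert nQ card_insert_corner QE !andbT.
apply/fsubsetP => y /insert_cornerP[->//|[x xQ ->]].
by rewrite -in_delete_cross (fsubsetP QF).
Qed.

Lemma NAR_no_corner F c r :
  [fset P in NAR F r | c \notin P] = NAR (F `\ c) r.
Proof.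
apply/fsetP => P; rewrite !inE /= !fpowersetE fsubsetD1.
by rewrite -!andbA; congr andb; rewrite andbA andbC.
Qed.

(** [bump] is increasing and, as the coordinates of [c] are positive, fixes 0; both bounds of an
    attacked segment are therefore preserved. *)
Lemma attacks_bump2 c p x : 0 < c.1 -> 0 < c.2 ->
  attacks (bump2 c p) (bump2 c x) = attacks p x.
Proof.
move=> c1 c2; rewrite /attacks /= !(inj_eq (can_inj (bumpK _))) !leq_bump2.
by congr (_ && (_ && _) || _ && (_ && _)); rewrite /bump; lia.
Qed.

(** By maximality of [c], no cell of its row or column lies beyond it, so the rook on [c] attacks
    all of both within [F]. Away from this cross, [bump2 c] preserves attacks. *)
Lemma inv_insert_corner F c Q : ferrers_diagram F -> corner F c ->
  Defs.inv F (insert_corner c Q) = Defs.inv (delete_cross F c) Q.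
Proof.
move=> fF [cF cc]; have [c1 c2] := ferrers_gt0 fF cF.
rewrite /Defs.inv.
suff -> : F `\` ATK (insert_corner c Q) =
          [fset bump2 c x | x in delete_cross F c `\` ATK Q].
  by rewrite card_imfset //; exact: bump2_inj.
apply/fsetP => y; rewrite in_fsetD; apply/andP/imfsetP => /= [[yA yF]|].
  have nyc : ~~ attacks c y.
    by apply: contra yA => yc; apply/in_ATK; exists c => //; exact: corner_in_insert.
  have [y1 y2] := ferrers_gt0 fF yF.
  have [||x yx] := @bump2_surj c y.
  - apply: contra nyc => /eqP E; rewrite /attacks.
    have [yc|/ltnW-cy] := leqP y.2 c.2; first by rewrite E eqxx y2 orbT.
    by rewrite (cc y yF) // ?E // eqxx c1 leqnn.
  - apply: contra nyc => /eqP E; rewrite /attacks.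
    have [yc|/ltnW-cy] := leqP y.1 c.1; first by rewrite E eqxx y1.
    by rewrite (cc y yF) // ?E // !eqxx c2 leqnn orbT.
  exists x => //; rewrite in_fsetD in_delete_cross -yx yF andbT.
  apply: contra yA => /in_ATK[p pQ px]; apply/in_ATK.
  by exists (bump2 c p); rewrite ?bump2_in_insert // yx attacks_bump2.
move=> [x]; rewrite in_fsetD in_delete_cross => /andP[xA xF] ->; split=> //.
apply: contra xA => /in_ATK[p /insert_cornerP[->|[q qQ ->]]].
  have [/negPf n1 /negPf n2] := bump2_neq c x.
  by rewrite /attacks n1 n2.
by rewrite attacks_bump2 // => qx; apply/in_ATK; exists q.
Qed.

(** A rook attacks only towards the axes, so one attacking the maximal cell [c] would stand on [c]
    itself. Thus [c] is one extra unattacked cell. *)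
Lemma inv_no_corner F c P : corner F c -> P `<=` F `\ c ->
  Defs.inv F P = (Defs.inv (F `\ c) P).+1.
Proof.
move=> [cF cc] PF.
have cA : c \notin ATK P.
  apply/negP => /in_ATK[p /(fsubsetP PF)]; rewrite in_fsetD1 => /andP[/eqP pc pF].
  move=> cp; apply: pc; apply: cc => //; move: cp; rewrite /attacks;
  by case/orP => /andP[/eqP E /andP[_ ]]; rewrite ?E.
rewrite /Defs.inv (cardfsD1 c) in_fsetD cA cF; congr (_.+1).
by rewrite !fsetDDl fsetUC.
Qed.

Lemma rook_poly_corner F c r : ferrers_diagram F -> corner F c ->
  (rook_poly r F =
   rook_poly r (F `\ c) * 'X + rook_poly (r - 1) (delete_cross F c))%R.
Proof.
move=> fF cc; rewrite {1}/rook_poly (big_fsetID _ (fun P => c \in P)) [RHS]addrC /=.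
rewrite NAR_corner ?NAR_no_corner; last exact: cc.1.
congr (_ + _)%R.
  rewrite big_imfset /=; last by move=> P Q _ _; exact: insert_corner_inj.
  by apply: eq_bigr => Q _; rewrite inv_insert_corner.
rewrite /rook_poly mulr_suml big_seq [RHS]big_seq; apply: eq_bigr => P.
by rewrite in_NAR => /and3P[PF _ _]; rewrite (inv_no_corner cc PF) exprSr.
Qed.

(** * The zeroth rook polynomial and the largest placements *)

Lemma rook_poly0 F : (rook_poly 0 F = 'X^#|` F|)%R.
Proof.
rewrite /rook_poly.
have -> : NAR F 0 = [fset fset0].
  apply/fsetP => P; rewrite in_NAR inE eqz_nat cardfs_eq0.
  apply/and3P/eqP => [[_ _ /eqP//]|->].
  by split; rewrite ?fsub0set //; apply/nonattackingP => x y; rewrite inE.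
rewrite big_seq_fset1 /Defs.inv; congr ('X^_)%R; congr (#|` _|).
apply/fsetP => x; rewrite in_fsetD; case: in_ATK => //= -[p].
by rewrite inE.
Qed.

(** At q = 1 the polynomial counts the placements, so nothing cancels. *)
Lemma rook_poly_eq0 F r : (rook_poly r F == 0%R) = (NAR F r == fset0).
Proof.
apply/eqP/eqP => [|NF]; last by rewrite /rook_poly NF big_seq_fset0.
move=> /(congr1 (fun p : {poly int} => p.[1]))%R.
rewrite /rook_poly horner_sum horner0.
under eq_bigr do rewrite hornerXn expr1n.
rewrite big_const_seq count_predT iter_addr_0 => /eqP.
by rewrite pnatr_eq0 cardfs_eq0 => /eqP.
Qed.

Lemma max_rooks_ge F k : NAR F (Posz k) != fset0 -> k <= max_rooks F.
Proof.
move=> NF.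
have kF : k < #|` F|.+1.
  move/fset0Pn: NF => [P]; rewrite in_NAR => /and3P[PF _ /eqP[<-]].
  exact: fsubset_leq_card.
exact: (@leq_bigmax_cond _ _ (fun i => nat_of_ord i) (Ordinal kF)).
Qed.

Lemma NAR_max_rooks F : NAR F (Posz (max_rooks F)) != fset0.
Proof.
(* The empty placement settles the value 0, which starts the maximum. *)
have N0 : NAR F 0%R != fset0.
  by rewrite -rook_poly_eq0 rook_poly0 monic_neq0 // monicXn.
rewrite /max_rooks; elim/big_ind: _ => // k k' Hk Hk'.
by rewrite /maxn; case: ifP.
Qed.

(** * Diagonal sequences *)

(** Lets trailing zeros be added or removed: only the entries matter, with 0 past the end. *)
Lemma has_diagonals_nth F d d' :
  nth 0 d =1 nth 0 d' -> has_diagonals F d -> has_diagonals F d'.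
Proof.
by move=> E /has_diagonalsE[fF H]; apply/has_diagonalsE; split=> // k; rewrite H.
Qed.

Lemma nth_map_predn d k : nth 0 (map predn d) k = (nth 0 d k).-1.
Proof.
have [kd|dk] := ltnP k (size d); first by rewrite (nth_map 0).
by rewrite !nth_default ?size_map.
Qed.

Lemma nth_rcons0 d k : nth 0 (rcons d 0) k = nth 0 d k.
Proof. by rewrite nth_rcons; case: ltngtP => // H; rewrite nth_default // ?H // ltnW. Qed.

Lemma corner_recursion F d m : has_diagonals F (rcons d m.+1) ->
  exists c, [/\ has_diagonals (F `\ c) (rcons d m),
    has_diagonals (delete_cross F c) (map predn (behead (rcons d m.+1))) &
    forall r, (rook_poly r F =
      rook_poly r (F `\ c) * 'X + rook_poly (r - 1) (delete_cross F c))%R].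
Proof.
move=> /has_diagonalsE[fF H].
have Hl : diag_size F (size d) = m.+1 by rewrite H nth_rcons ltnn eqxx.
have /diag_size_gt0[c cF [_ _ cE]] : 0 < diag_size F (size d) by rewrite Hl.
have cl : last_diagonal_cell F (size d) c.
  by split=> // k dk; rewrite H nth_default // size_rcons.
exists c; split.
- apply/has_diagonalsE; split=> [|k]; first exact: ferrers_del_corner cl.
  have := diag_size_del fF cl k; rewrite H !nth_rcons.
  by case: ltngtP => // _; rewrite ?add0n // add1n => -[].
- apply/has_diagonalsE; split=> [|k]; first exact: ferrers_delete_cross cl.
  by rewrite (diag_size_delete_cross fF cl) H nth_map_predn nth_behead.
move=> r; apply: rook_poly_corner => //; split=> [//|x xF].
exact: (last_diagonal_corner fF cl xF).
Qed.

(** Induction on the length, then on the last entry: a last entry 0 is dropped, a positive one is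
    lowered by [corner_recursion], whose second diagram has a shorter sequence. *)
Lemma rook_poly_diagonals d F G r : has_diagonals F d -> has_diagonals G d ->
  rook_poly r F = rook_poly r G.
Proof.
have [n] := ubnP (size d); elim: n d F G r => // n IHn d.
elim/last_ind: d => [|d m _] F G r.
  move=> _ HF HG; suff E K : has_diagonals K [::] -> K = fset0 by rewrite (E F HF) (E G HG).
  by move=> /card_ferrers /= /eqP; rewrite cardfs_eq0 => /eqP.
rewrite size_rcons ltnS => dn; elim: m F G r => [|m IHm] F G r HF HG.
  by apply: (IHn d); rewrite // -?ltnS //; apply: has_diagonals_nth (nth_rcons0 d) _.
have [c [HFc HFc' ->]] := corner_recursion HF.
have [c' [HGc HGc' ->]] := corner_recursion HG.
rewrite (IHm _ _ _ HFc HGc) (IHn _ _ _ _ _ HFc' HGc') //.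
by rewrite size_map size_behead size_rcons.
Qed.

Lemma on_diagramsE (T : choiceType) (x0 : T) (f : {fset cell} -> T) d F :
  has_diagonals F d -> (forall G, has_diagonals G d -> f G = f F) ->
  on_diagrams x0 f d = f F.
Proof.
by move=> HF fE; apply: xget_unique => // y /(_ F HF) ->.
Qed.

Lemma rook_poly_seqE F d r : has_diagonals F d -> rook_poly_seq r d = rook_poly r F.
Proof. by move=> HF; apply: on_diagramsE => // G HG; apply: rook_poly_diagonals HF. Qed.

(** The rook polynomials determine which placement sizes occur, since they vanish exactly when there
    is no placement. *)
Lemma max_rooks_seqE F d : has_diagonals F d -> max_rooks_seq d = max_rooks F.
Proof.
move=> HF; apply: on_diagramsE => // G HG.
have le K L : has_diagonals K d -> has_diagonals L d -> max_rooks K <= max_rooks L.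
  move=> HK HL; apply: max_rooks_ge; rewrite -rook_poly_eq0.
  by rewrite (rook_poly_diagonals _ HL HK) rook_poly_eq0 NAR_max_rooks.
by apply/eqP; rewrite eqn_leq !le.
Qed.

(** * A diagram for every Ferrers sequence *)

Lemma diag_size_le F k : diag_size F k <= k.+1.
Proof.
rewrite -[leqRHS]card_ord -sum1_card; apply: leq_sum => i _; exact: leq_b1.
Qed.

Lemma sum_ltn_ord m n : \sum_(i < n) (i < m) = minn m n.
Proof.
elim: n => [|n IHn]; first by rewrite big_ord0 minn0.
by rewrite big_ord_recr /= IHn; lia.
Qed.

Lemma ferrers_seq_le d k : ferrers_seq d -> nth 0 d k <= k.+1.
Proof.
have [dk _|] := leqP (size d) k; first by rewrite nth_default.
elim: k => [|k IHk] kd.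
  move=> [H|[r r1 [H _]]]; first by have -> : nth 0 d 0 = 0 := H 1 kd.
  by have -> : nth 0 d 0 = 1 by apply: (H 1); lia.
move=> hd; have [H|[r r1 [H1 H2]]] := hd; first by have -> : nth 0 d k.+1 = 0 := H k.+2 kd.
have [kr|rk] := leqP k.+2 r; first by have -> : nth 0 d k.+1 = k.+2 by apply: (H1 k.+2).
have : nth 0 d k.+1 <= nth 0 d k by apply: (H2 k.+1); lia.
by have := IHk (ltnW kd) hd; lia.
Qed.

(** Local form of the definition: the entries can grow only after a full diagonal. This is what
    makes [standard_diagram] closed towards the axes. *)
Lemma ferrers_seq_step d k : ferrers_seq d ->
  nth 0 d k.+1 <= nth 0 d k \/ nth 0 d k = k.+1.
Proof.
have [dk _|kd] := leqP (size d) k.+1; first by left; rewrite nth_default.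
move=> [H|[r r1 [H1 H2]]]; first by left; have -> : nth 0 d k.+1 = 0 := H k.+2 kd.
have [kr|rk] := leqP k.+1 r; first by right; apply: (H1 k.+1).
by left; apply: (H2 k.+1); lia.
Qed.

(* Each diagonal is filled starting from its first column. *)
Definition standard_diagram d : {fset cell} :=
  [fset x in [seq (s, t) | s <- iota 1 (size d), t <- iota 1 (size d)]
   | x.2 <= nth 0 d (x.1 + x.2 - 2)].

Lemma in_standard_diagram d s t :
  ((s.+1, t.+1) \in standard_diagram d) = (t < nth 0 d (s + t)).
Proof.
rewrite !inE /= addSn addnS !subSS subn0.
apply/andP/idP => [[]//|H]; split=> //.
have std : s + t < size d by rewrite ltnNge; apply: contraL H => H; rewrite nth_default.
by apply/allpairsP; exists (s.+1, t.+1); rewrite !mem_iota /=; split=> //; lia.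
Qed.

Lemma standard_diagram_gt0 d x : x \in standard_diagram d -> 0 < x.1 /\ 0 < x.2.
Proof.
rewrite !inE => /andP[/allpairsP[[s t]]] [] /=; rewrite !mem_iota => s1 t1 -> _.
by split=> /=; lia.
Qed.

Lemma standard_diagramP d : ferrers_seq d -> has_diagonals (standard_diagram d) d.
Proof.
move=> hd; apply/has_diagonalsE; split=> [i j|k].
  move=> ijF; have [/= i0 j0] := standard_diagram_gt0 ijF; split=> //.
  case: i i0 ijF => // i _; case: j j0 => // j _; rewrite in_standard_diagram => ijF.
  (* From a diagonal to the previous one, either the entry does not drop or the previous diagonal is
     full; the cell survives in both cases. *)
  have up s t : t < nth 0 d (s.+1 + t) -> t < nth 0 d (s + t).
    by have := ferrers_seq_step (s + t) hd; rewrite addSn; lia.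
  have left s t : t.+1 < nth 0 d (s + t.+1) -> t < nth 0 d (s + t).
    by have := ferrers_seq_step (s + t) hd; rewrite addnS; lia.
  have ups s : s <= i -> j < nth 0 d (s + j).
    move=> si; have -> : s = i - (i - s) by lia.
    elim: (i - s) => [|n IHn]; first by rewrite subn0.
    (* Once [n] reaches [i], truncated subtraction keeps the row at 0 and nothing changes. *)
    have [ni|ni] := ltnP n i; last by have -> : i - n.+1 = i - n by lia.
    by apply: up; have -> : (i - n.+1).+1 = i - n by lia.
  move=> [|s] [|t] // si tj; rewrite in_standard_diagram.
  have {}si : s <= i by lia.
  have -> : t = j - (j - t) by lia.
  elim: (j - t) => [|n IHn]; first by rewrite subn0; apply: ups.
  have [nj|nj] := ltnP n j; last by have -> : j - n.+1 = j - n by lia.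
  by apply: left; have -> : (j - n.+1).+1 = j - n by lia.
transitivity (\sum_(i < k.+1) (i < nth 0 d k)); last first.
  by rewrite sum_ltn_ord (minn_idPl _) // ferrers_seq_le.
(* [diag_size] runs through rows while diagonals are filled by columns; after the reversal, [i] is
   the column counted from 0. *)
rewrite /diag_size (reindex_inj rev_ord_inj); apply: eq_bigr => i _ /=.
have ik := ltn_ord i.
have -> : k.+1 - (k.+1 - i.+1) = i.+1 by lia.
by rewrite in_standard_diagram; have -> : k.+1 - i.+1 + i = k by lia.
Qed.

(** * The recursion along the last diagonal *)

Lemma drop_last_rcons d m : drop_last (rcons d m) = d.
Proof. by rewrite /drop_last size_rcons -cats1 take_size_cat. Qed.

Lemma reduced_seq_rcons d m j :
  reduced_seq (rcons d m) j = rcons (map predn (behead d)) j.-1.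
Proof. by rewrite /reduced_seq drop_last_rcons. Qed.

Lemma rook_poly_last_diagonal d m F r : has_diagonals F (rcons d m) ->
  (rook_poly r F = rook_poly_seq r d * 'X^m +
     \sum_(1 <= j < m.+1) rook_poly_seq (r - 1) (reduced_seq (rcons d m) j)
                          * 'X^(m - j))%R.
Proof.
under eq_bigr do rewrite reduced_seq_rcons.
elim: m F => [|m IHm] F HF.
  rewrite big_geq // expr0 mulr1 addr0; apply/esym/rook_poly_seqE.
  exact: has_diagonals_nth (nth_rcons0 d) HF.
have [c [HFc HFc' ->]] := corner_recursion HF.
(* The deleted corner contributes the new term j = m + 1 with exponent 0; the factor q raises all
   earlier exponents by one. *)
rewrite (IHm _ HFc) [in RHS]big_nat_recr //= subnn expr0 mulr1 addrA; congr (_ + _)%R.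
  rewrite mulrDl exprSr mulrA; congr (_ + _)%R.
  rewrite mulr_suml !big_nat; apply: eq_bigr => j /andP[_ jm].
  by rewrite -mulrA -exprSr -subSn.
apply/esym/rook_poly_seqE; apply: has_diagonals_nth HFc' => k.
case: d HF {IHm HFc} => [|a d] HF /=; last by rewrite map_rcons.
(* For l = 1 the first diagonal has at most one cell, so m = 0 and the sequence (0) agrees entrywise
   with the empty one. *)
have /has_diagonalsE[_ /(_ 0) /= H] := HF.
have := diag_size_le F 0; rewrite H ltnS leqn0 => /eqP ->.
by case: k => [|[]].
Qed.

End RookPolynomials.

Theorem theorem3p5 (r : int) (l : nat) (d : l.-tuple nat)
    (hl : (1 <= l)%N) (hd : ferrers_seq d) :
  [/\ 1 <= r <= Posz (max_rooks_seq d) ->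
      rook_poly_seq r d =
        rook_poly_seq r (drop_last d) * 'X^(entry d l)
        + \sum_(1 <= j < (entry d l).+1)
            rook_poly_seq (r - 1) (reduced_seq d j) * 'X^(entry d l - j),
      rook_poly_seq 0 d = 'X^(\sum_(1 <= i < l.+1) entry d i)
    & Posz (max_rooks_seq d) < r \/ r < 0 -> rook_poly_seq r d = 0].
Proof.
(* A diagram realizing [d] turns the descriptions behind [rook_poly_seq] and [max_rooks_seq] into
   actual values. *)
have HF := standard_diagramP hd; split.
- move=> _; rewrite (rook_poly_seqE _ HF).
  have dE : rcons (drop_last d) (entry d l) = d.
    rewrite /drop_last /entry size_tuple -take_nth ?prednK ?size_tuple //.
    by rewrite take_oversize // size_tuple.
  have HF' : has_diagonals (standard_diagram d) (rcons (drop_last d) (entry d l)).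
    by rewrite dE.
  by rewrite (rook_poly_last_diagonal _ HF') dE.
- rewrite (rook_poly_seqE _ HF) rook_poly0 (card_ferrers HF) sumnE (big_nth 0%N).
  by rewrite size_tuple big_add1.
rewrite (rook_poly_seqE _ HF) (max_rooks_seqE HF) => Hr.
apply/eqP; rewrite rook_poly_eq0; apply/negPn/negP => NF.
case: r NF Hr => [k|k] NF [] //.
  by rewrite ltz_nat ltnNge max_rooks_ge.
move/fset0Pn: NF => [P]; rewrite in_NAR => /and3P[_ _ //].
Qed.
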